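(* Let $r\geq0$ and let $\mathscr{U}\subseteq\mathscr{G}$ be a full, replete and widely closed subcategory in which all groups are $r$-generated, and suppose that $\mathscr{U}$ has a profinite reflective filtration $\{\mathscr{U}[n]\}_{n\geq0}$ with reflections $q_n\colon\widehat{\mathscr{U}}\to\mathscr{U}[n]$. Then the map induced by the reflections $$q=(q_n)\colon\pi_0\widehat{\mathscr{U}}\xrightarrow{\ \sim\ }\lim_n\pi_0\mathscr{U}[n],\qquad[G]\mapsto([q_nG])_n,$$ is a bijection.
   Context: $\mathscr{G}$ is the category of finite groups with morphisms the conjugacy classes of surjective group homomorphisms. A group is $r$-generated if it can be generated by at most $r$ elements. A full subcategory $\mathscr{U}\subseteq\mathscr{G}$ closed under isomorphism (replete) is widely closed if whenever $G\twoheadleftarrow H\twoheadrightarrow K$ are surjective homomorphisms with $G,H,K\in\mathscr{U}$, the image of $H\to G\times K$ lies in $\mathscr{U}$. $\pi_0$ denotes the set of isomorphism classes of objects. The profinite extension $\widehat{\mathscr{U}}$ is the category of topologically finitely generated profinite groups $G$ such that the set $\mathcal{N}(G;\mathscr{U})$ of open normal subgroups $N$ with $G/N\in\mathscr{U}$ is cofinal among all open normal subgroups of $G$; morphisms are conjugacy classes of surjective (continuous) homomorphisms. One has $\mathscr{U}\subseteq\widehat{\mathscr{U}}$. A reflective filtration of $\mathscr{U}$ is a sequence of full replete subcategories $\mathscr{U}[0]\subseteq\mathscr{U}[1]\subseteq\cdots\subseteq\mathscr{U}$ with $\bigcup_n\mathscr{U}[n]=\mathscr{U}$ such that each inclusion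 $\mathscr{U}[n]\to\mathscr{U}$ has a left adjoint. It is profinite if each inclusion $\mathscr{U}[n]\to\widehat{\mathscr{U}}$ has a left adjoint $q_n\colon\widehat{\mathscr{U}}\to\mathscr{U}[n]$; then $q_n(G)=G/N_n(G)$ with $N_n(G)$ the smallest open normal subgroup of $G$ with quotient in $\mathscr{U}[n]$. The transition maps $\pi_0\mathscr{U}[n+1]\to\pi_0\mathscr{U}[n]$ in the limit are induced by $q_n$. *)

(* Defs.v *)
From HB Require Import structures.
From mathcomp Require Import all_boot all_fingroup.
From mathcomp Require Import all_classical.
From mathcomp Require Import topology.

Set Implicit Arguments.
Unset Strict Implicit.
Unset Printing Implicit Defensive.

Local Open Scope classical_set_scope.
Local Open Scope group_scope.

Declare Scope cat_scope.
Delimit Scope cat_scope with cat.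

Record category := Category {
  obj :> Type;
  chom : obj -> obj -> Type;
  idm : forall x, chom x x;
  ccomp : forall x y z, chom y z -> chom x y -> chom x z;
  ccompA : forall x y z t (h : chom z t) (g : chom y z) (f : chom x y),
    ccomp h (ccomp g f) = ccomp (ccomp h g) f;
  ccomp1m : forall x y (f : chom x y), ccomp (idm y) f = f;
  ccompm1 : forall x y (f : chom x y), ccomp f (idm x) = f }.

Notation "g \oc f" := (ccomp g f) (at level 50, left associativity) : cat_scope.
Local Open Scope cat_scope.

Record functor (C D : category) := Functor {
  fobj :> C -> D;
  fmor : forall x y, chom x y -> chom (fobj x) (fobj y);
  fmor1 : forall x, fmor (idm x) = idm (fobj x);
  fmorM : forall x y z (g : chom y z) (f : chom x y),
    fmor (g \oc f) = fmor g \oc fmor f }.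

Definition id_functor (C : category) : functor C C :=
  @Functor C C (fun x => x) (fun x y f => f) (fun x => erefl)
    (fun x y z g f => erefl).

Section CompFunctor.
Variables (C D E : category) (G : functor D E) (F : functor C D).

Lemma comp_fmap1 (x : C) : fmor G (fmor F (idm x)) = idm (G (F x)).
Proof. by rewrite !fmor1. Qed.

Lemma comp_fmapM (x y z : C) (g : chom y z) (f : chom x y) :
  fmor G (fmor F (g \oc f)) = fmor G (fmor F g) \oc fmor G (fmor F f).
Proof. by rewrite !fmorM. Qed.

Definition comp_functor : functor C E :=
  @Functor C E (fun x => G (F x)) (fun x y f => fmor G (fmor F f))
    comp_fmap1 comp_fmapM.

End CompFunctor.

Definition is_left_adjoint (C D : category)
    (L : functor C D) (R : functor D C) : Prop :=
  exists phi : forall (x : C) (y : D), chom (L x) y -> chom x (R y),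
    (forall x y, bijective (phi x y)) /\
    (forall (x x' : C) (y y' : D) (f : chom x' x) (g : chom y y')
        (h : chom (L x) y),
      phi x' y' (g \oc h \oc fmor L f) = fmor R g \oc phi x y h \oc f).

Definition has_left_adjoint (C D : category) (R : functor D C) : Prop :=
  exists L : functor C D, is_left_adjoint L R.

Definition isomorphic (C : category) (x y : C) : Prop :=
  exists (f : chom x y) (g : chom y x), g \oc f = idm x /\ f \oc g = idm y.

Lemma isomorphic_refl (C : category) (x : C) : isomorphic x x.
Proof. by exists (idm x), (idm x); rewrite ccomp1m. Qed.

Lemma isomorphic_sym (C : category) (x y : C) :
  isomorphic x y -> isomorphic y x.
Proof. by move=> [f [g [gf fg]]]; exists g, f. Qed.

Lemma isomorphic_trans (C : category) (x y z : C) :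
  isomorphic x y -> isomorphic y z -> isomorphic x z.
Proof.
move=> [f [g [gf fg]]] [h [k [kh hk]]]; exists (h \oc f), (g \oc k).
split.
  by rewrite -ccompA (ccompA k h f) kh ccomp1m.
by rewrite -ccompA (ccompA f g k) fg ccomp1m.
Qed.

Lemma functor_isomorphic (C D : category) (F : functor C D) (x y : C) :
  isomorphic x y -> isomorphic (F x) (F y).
Proof.
move=> [f [g [gf fg]]]; exists (fmor F f), (fmor F g).
by rewrite -!fmorM gf fg !fmor1.
Qed.

Definition full_sub (C : category) (P : C -> Prop) : category :=
  @Category {x : C | P x}
    (fun x y => chom (sval x) (sval y))
    (fun x => idm (sval x))
    (fun x y z => @ccomp C (sval x) (sval y) (sval z))
    (fun x y z t => @ccompA C (sval x) (sval y) (sval z) (sval t))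
    (fun x y => @ccomp1m C (sval x) (sval y))
    (fun x y => @ccompm1 C (sval x) (sval y)).

Definition replete (C : category) (P : C -> Prop) : Prop :=
  forall x y : C, isomorphic x y -> P x -> P y.

Definition full_sub_functor (C D : category) (F : functor C D)
    (P : C -> Prop) (Q : D -> Prop) (PQ : forall x, P x -> Q (F x)) :
    functor (full_sub P) (full_sub Q) :=
  @Functor (full_sub P) (full_sub Q)
    (fun x => exist Q (F (sval x)) (PQ (sval x) (svalP x)))
    (fun x y => @fmor C D F (sval x) (sval y))
    (fun x => @fmor1 C D F (sval x))
    (fun x y z => @fmorM C D F (sval x) (sval y) (sval z)).

Definition full_sub_incl (C : category) (P Q : C -> Prop)
    (PQ : forall x, P x -> Q x) : functor (full_sub P) (full_sub Q) :=
  @full_sub_functor C C (id_functor C) P Q PQ.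

Definition pi0 (C : category) : Type :=
  {A : C -> Prop | exists x : C, A = isomorphic x}.

Definition pi0_class (C : category) (x : C) : pi0 C :=
  exist _ (isomorphic x) (ex_intro _ x erefl).

Lemma pi0_class_eq (C : category) (x y : C) :
  pi0_class x = pi0_class y <-> isomorphic x y.
Proof.
split=> [/(congr1 sval) /= e|xy].
  by rewrite e; exact: isomorphic_refl.
apply: eq_exist; apply/funext => z; apply/propext; split.
  exact/isomorphic_trans/isomorphic_sym.
exact: isomorphic_trans.
Qed.

Lemma pi0_ind (C : category) (A : pi0 C) : exists x, A = pi0_class x.
Proof. by case: A => A [x eA]; exists x; apply: eq_exist. Qed.

Lemma pi0_map_subproof (C D : category) (F : functor C D) (A : pi0 C) :
  exists y : D,
    (fun z => exists2 x, sval A x & isomorphic (F x) z) = isomorphic y.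
Proof.
case: A => A [x /= ->]; exists (F x); apply/funext => z; apply/propext.
split=> [[x' xx' x'z]|xz]; last by exists x => //; exact: isomorphic_refl.
exact: isomorphic_trans (functor_isomorphic F xx') x'z.
Qed.

Definition pi0_map (C D : category) (F : functor C D) (A : pi0 C) : pi0 D :=
  exist _ (fun z => exists2 x, sval A x & isomorphic (F x) z)
    (pi0_map_subproof F A).

Lemma pi0_mapE (C D : category) (F : functor C D) (x : C) :
  pi0_map F (pi0_class x) = pi0_class (F x).
Proof.
apply: eq_exist; apply/funext => z; apply/propext.
split=> /= [[x' xx' x'z]|xz]; last by exists x => //; exact: isomorphic_refl.
exact: isomorphic_trans (functor_isomorphic F xx') x'z.
Qed.

Definition seq_lim (X : nat -> Type) (t : forall n, X n.+1 -> X n) : Type :=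
  {s : forall n, X n | forall n, t n (s n.+1) = s n}.

Definition surj_hom (G H : groupType) (f : G -> H) : Prop :=
  {morph f : x y / x * y} /\ (forall y, exists x, f x = y).

Definition conj_class (G H : groupType) (f : G -> H) : (G -> H) -> Prop :=
  fun f' => exists h : H, f' = (fun x => f x ^ h).

Lemma conj_class_refl (G H : groupType) (f : G -> H) : conj_class f f.
Proof. by exists 1; apply/funext => x; rewrite conjg1. Qed.

Section ConjCategory.
Variables (T : Type) (grp : T -> groupType).
Variable mor : forall G H : T, (grp G -> grp H) -> Prop.
Hypothesis mor_hom : forall G H f, @mor G H f -> surj_hom f.
Hypothesis mor_id : forall G, @mor G G idfun.
Hypothesis mor_comp : forall G H K (g : grp H -> grp K) (f : grp G -> grp H),
  mor g -> mor f -> mor (g \o f).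

(* A morphism is a whole conjugacy class, as a set of functions, so that
   equality of morphisms is Leibniz equality; only conjugation by elements of
   the target is needed, since [f (x ^ g) = f x ^ f g]. *)
Definition conj_hom (G H : T) : Type :=
  {A : (grp G -> grp H) -> Prop | exists2 f, mor f & A = conj_class f}.

Definition class_hom (G H : T) (f : grp G -> grp H) (mf : mor f) :
    conj_hom G H :=
  exist _ (conj_class f) (ex_intro2 _ _ f mf erefl).

Lemma conj_class_comp (G H K : T) (g : grp H -> grp K) (f : grp G -> grp H) :
  mor g ->
  (fun k => exists g' f', [/\ conj_class g g', conj_class f f' & k = g' \o f'])
    = conj_class (g \o f).
Proof.
move=> mg; have [gM _] := mor_hom mg; apply/funext => k; apply/propext.
split=> [[_ [_ [[a ->] [b ->] ->]]]|[a ->]].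
  exists (g b * a); apply/funext => x /=.
  have gV : g b^-1 = (g b)^-1.
    apply: (mulgI (g b)); rewrite mulgV -gM mulgV.
    by apply: (mulgI (g 1)); rewrite mulg1 -gM mulg1.
  by rewrite conjgM !conjgE !gM gV.
exists (fun y => g y ^ a), f; split => //; first by exists a.
exact: conj_class_refl.
Qed.

Lemma conj_comp_subproof (G H K : T) (B : conj_hom H K) (A : conj_hom G H) :
  exists2 h, mor h &
    (fun k => exists g f, [/\ sval B g, sval A f & k = g \o f]) = conj_class h.
Proof.
case: A => A [f mf /= ->]; case: B => B [g mg /= ->].
by exists (g \o f); [exact: mor_comp|exact: conj_class_comp].
Qed.

Definition conj_comp (G H K : T) (B : conj_hom H K) (A : conj_hom G H) :
    conj_hom G K :=
  exist _ (fun k => exists g f, [/\ sval B g, sval A f & k = g \o f])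
    (conj_comp_subproof B A).

Lemma conj_compE (G H K : T) (g : grp H -> grp K) (f : grp G -> grp H)
    (mg : mor g) (mf : mor f) (mgf : mor (g \o f)) :
  conj_comp (class_hom mg) (class_hom mf) = class_hom mgf.
Proof. by apply: eq_exist; exact: conj_class_comp. Qed.

Lemma conj_hom_ind (G H : T) (A : conj_hom G H) :
  exists f (mf : mor f), A = class_hom mf.
Proof. by case: A => A [f mf eA]; exists f, mf; apply: eq_exist. Qed.

Lemma conj_compA (G H K L : T) (C : conj_hom K L) (B : conj_hom H K)
    (A : conj_hom G H) :
  conj_comp C (conj_comp B A) = conj_comp (conj_comp C B) A.
Proof.
have [h [mh ->]] := conj_hom_ind C; have [g [mg ->]] := conj_hom_ind B.
have [f [mf ->]] := conj_hom_ind A.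
have mgf := mor_comp mg mf; have mhg := mor_comp mh mg.
have mhgf := mor_comp mh mgf; have mhgf' : mor ((h \o g) \o f) := mhgf.
rewrite (conj_compE _ _ mgf) (conj_compE _ _ mhgf) (conj_compE _ _ mhg).
by rewrite (conj_compE _ _ mhgf'); apply: eq_exist.
Qed.

Lemma conj_comp1m (G H : T) (A : conj_hom G H) :
  conj_comp (class_hom (mor_id H)) A = A.
Proof.
have [f [mf ->]] := conj_hom_ind A.
exact: (@conj_compE _ _ _ idfun f _ _ mf).
Qed.

Lemma conj_compm1 (G H : T) (A : conj_hom G H) :
  conj_comp A (class_hom (mor_id G)) = A.
Proof.
have [f [mf ->]] := conj_hom_ind A.
exact: (@conj_compE _ _ _ f idfun _ _ mf).
Qed.

Definition conj_category : category :=
  Category conj_compA conj_comp1m conj_compm1.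

End ConjCategory.

Definition fin_mor (G H : finGroupType) (f : G -> H) : Prop := surj_hom f.

Lemma fin_mor_id (G : finGroupType) : @fin_mor G G idfun.
Proof. by split=> // y; exists y. Qed.

Lemma fin_mor_comp (G H K : finGroupType) (g : H -> K) (f : G -> H) :
  fin_mor g -> fin_mor f -> fin_mor (g \o f).
Proof.
move=> [gM gS] [fM fS]; split=> [x y /=|z]; first by rewrite fM gM.
by have [y <-] := gS z; have [x <-] := fS y; exists x.
Qed.

Definition FinGrp : category :=
  @conj_category finGroupType (fun G => G) fin_mor
    (fun G H f mf => mf) fin_mor_id fin_mor_comp.

Definition r_generated (r : nat) (G : finGroupType) : Prop :=
  exists A : {set G}, (#|A| <= r)%N /\ <<A>> = [set: G]%SET.

(* The image of [H -> G * K] is a subgroup of the external direct product;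
   it is named here by quantifying over the subgroup [L] with this carrier. *)
Definition widely_closed (U : FinGrp -> Prop) : Prop :=
  forall (G H K : finGroupType) (f : H -> G) (g : H -> K),
    U G -> U H -> U K -> surj_hom f -> surj_hom g ->
    forall L : {group (G * K)%type},
      L = [set (f x, g x) | x : H]%SET :> {set (G * K)%type} ->
      U (subg_of L).

HB.mixin Record isTopologicalGroup G of monoid.Group G & Topological G := {
  mulg_continuous : continuous (fun p : G * G => p.1 * p.2);
  invg_continuous : continuous (fun x : G => x^-1) }.

#[short(type="topologicalGroupType")]
HB.structure Definition TopologicalGroup :=
  {G of monoid.Group G & Topological G & isTopologicalGroup G}.

HB.mixin Record TopologicalGroup_isProfinite G of TopologicalGroup G := {
  profinite_compact : compact [set: G];
  profinite_hausdorff : hausdorff_space G;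
  profinite_totally_disconnected : totally_disconnected [set: G] }.

#[short(type="profiniteGroupType")]
HB.structure Definition ProfiniteGroup :=
  {G of TopologicalGroup G & TopologicalGroup_isProfinite G}.

Definition prof_mor (G H : profiniteGroupType) (f : G -> H) : Prop :=
  surj_hom f /\ continuous f.

Lemma prof_mor_id (G : profiniteGroupType) : @prof_mor G G idfun.
Proof. by split=> [|x]; [split=> // y; exists y|exact: cvg_id]. Qed.

Lemma prof_mor_comp (G H K : profiniteGroupType) (g : H -> K) (f : G -> H) :
  prof_mor g -> prof_mor f -> prof_mor (g \o f).
Proof.
move=> [[gM gS] gC] [[fM fS] fC]; split; last first.
  by move=> x; apply: continuous_comp; [exact: fC|exact: gC].
split=> [x y /=|z]; first by rewrite fM gM.
by have [y <-] := gS z; have [x <-] := fS y; exists x.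
Qed.

Definition ProfGrp : category :=
  @conj_category profiniteGroupType (fun G => G) prof_mor
    (fun G H f mf => proj1 mf) prof_mor_id prof_mor_comp.

Definition is_subgroup (G : groupType) (N : set G) : Prop :=
  N 1 /\ (forall x y, N x -> N y -> N (x * y^-1)).

Definition is_normal (G : groupType) (N : set G) : Prop :=
  is_subgroup N /\ (forall x y, N x -> N (x ^ y)).

Definition open_normal (G : profiniteGroupType) (N : set G) : Prop :=
  open N /\ is_normal N.

Definition top_finitely_generated (G : profiniteGroupType) : Prop :=
  exists s : seq G,
    closure (smallest (@is_subgroup G) [set x | x \in s]) = [set: G].

(* [quotient_in U N] reads [G / N \in U] for a replete [U]: some group of [U]
   is a quotient of [G] with kernel exactly [N]. *)
Definition quotient_in (U : FinGrp -> Prop) (G : profiniteGroupType)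
    (N : set G) : Prop :=
  exists (K : finGroupType) (f : G -> K),
    [/\ U K, surj_hom f & N = [set x | f x = 1]].

Definition normal_quotients (U : FinGrp -> Prop) (G : profiniteGroupType) :
    set (set G) :=
  [set N | open_normal N /\ quotient_in U N].

Definition profinite_ext (U : FinGrp -> Prop) : ProfGrp -> Prop :=
  fun G : profiniteGroupType =>
    top_finitely_generated G /\
    (forall M : set G, open_normal M ->
      exists2 N, normal_quotients U N & N `<=` M).

Section Discrete.
Variable G : finGroupType.
Local Notation D := (discrete_topology G).

HB.instance Definition _ := monoid.Group.copy D G.

Lemma discrete_mulg_continuous : continuous (fun p : D * D => p.1 * p.2).
Proof.
move=> [x y]; apply/(@discrete_cvg D).
exists ([set x], [set y]) => /=; first by split; exact: discrete_set1.
by move=> [a b] /= [-> ->].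
Qed.

Lemma discrete_invg_continuous : continuous (fun x : D => x^-1).
Proof.
move=> x; apply/(@discrete_cvg D).
apply: (@filterS D (nbhs x) _ [set x]); first by move=> _ /= ->.
exact: discrete_set1.
Qed.

HB.instance Definition _ := isTopologicalGroup.Build D
  discrete_mulg_continuous discrete_invg_continuous.

Lemma discrete_compact : compact [set: D].
Proof. by apply: finite_compact; exact: (@finite_finset G setT). Qed.

Lemma discrete_totally_disconnected : totally_disconnected [set: D].
Proof. exact/zero_dimension_totally_disconnected/discrete_zero_dimension. Qed.

HB.instance Definition _ := TopologicalGroup_isProfinite.Build D
  discrete_compact discrete_hausdorff discrete_totally_disconnected.

Definition discrete_group : profiniteGroupType := D.

End Discrete.

Lemma discrete_profinite_ext (U : FinGrp -> Prop) (G : FinGrp) :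
  U G -> profinite_ext U (discrete_group G).
Proof.
move=> UG; split.
  exists (enum G); rewrite -subTset => x _; apply: subset_closure.
  by apply: sub_gen_smallest; rewrite /= (mem_enum G).
move=> M [_ [[M1 _] _]]; exists [set 1]; last by move=> _ ->.
split; first (split; first exact: discrete_open).
  split; first by split=> // x y -> ->; rewrite /= mulgV.
  by move=> x y ->; rewrite /= conj1g.
by exists G, idfun; split=> //; exact: fin_mor_id.
Qed.

Lemma discrete_prof_mor (G H : finGroupType) (f : G -> H) :
  fin_mor f -> @prof_mor (discrete_group G) (discrete_group H) f.
Proof.
move=> mf; split=> // x; apply/(@discrete_cvg (discrete_topology H)).
apply: (@filterS (discrete_topology G) (nbhs x) _ [set x]).
  by move=> _ /= ->.
exact: discrete_set1.
Qed.

Lemma discrete_fmor_subproof (G H : FinGrp) (A : chom G H) :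
  exists2 f, @prof_mor (discrete_group G) (discrete_group H) f &
    sval A = conj_class f.
Proof.
by case: A => A [f mf /= ->]; exists f => //; exact: discrete_prof_mor.
Qed.

Definition discrete_fmor (G H : FinGrp) (A : chom G H) :
    @chom ProfGrp (discrete_group G) (discrete_group H) :=
  exist _ (sval A) (discrete_fmor_subproof A).

Lemma discrete_fmor1 (G : FinGrp) :
  discrete_fmor (idm G) = @idm ProfGrp (discrete_group G).
Proof. exact: eq_exist. Qed.

Lemma discrete_fmorM (G H K : FinGrp) (B : chom H K) (A : chom G H) :
  discrete_fmor (B \oc A) = discrete_fmor B \oc discrete_fmor A.
Proof. exact: eq_exist. Qed.

Definition discrete_functor : functor FinGrp ProfGrp :=
  @Functor FinGrp ProfGrp discrete_group discrete_fmor
    discrete_fmor1 discrete_fmorM.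

Definition incl_ext (U V : FinGrp -> Prop) (VU : forall G, V G -> U G) :
    functor (full_sub V) (full_sub (profinite_ext U)) :=
  @full_sub_functor FinGrp ProfGrp discrete_functor V (profinite_ext U)
    (fun G VG => discrete_profinite_ext (VU G VG)).

Record reflective_filtration (U : FinGrp -> Prop)
    (Un : nat -> FinGrp -> Prop) : Prop := ReflectiveFiltration {
  filt_sub : forall n G, Un n G -> U G;
  filt_mono : forall n G, Un n G -> Un n.+1 G;
  filt_cover : forall G, U G -> exists n, Un n G;
  filt_replete : forall n, replete (Un n);
  filt_reflective : forall n, has_left_adjoint (full_sub_incl (@filt_sub n)) }.

Section Limit.
Variables (U : FinGrp -> Prop) (Un : nat -> FinGrp -> Prop).
Hypothesis filt : reflective_filtration U Un.

Definition filt_incl_ext (n : nat) :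
    functor (full_sub (Un n)) (full_sub (profinite_ext U)) :=
  incl_ext (filt_sub filt (n := n)).

Variable q : forall n, functor (full_sub (profinite_ext U)) (full_sub (Un n)).
Hypothesis q_adj : forall n, is_left_adjoint (q n) (filt_incl_ext n).

Definition pi0_transition (n : nat) :
    pi0 (full_sub (Un n.+1)) -> pi0 (full_sub (Un n)) :=
  pi0_map (comp_functor (q n) (filt_incl_ext n.+1)).

Definition pi0_limit : Type := seq_lim pi0_transition.

Lemma discrete_fmor_full (G H : FinGrp)
    (A : @chom ProfGrp (discrete_group G) (discrete_group H)) :
  exists B : chom G H, A = discrete_fmor B.
Proof.
case: A => A [f mf eA]; have ff : fin_mor f by case: mf.
exists (exist _ A (ex_intro2 _ _ f ff eA)); exact: eq_exist.
Qed.

Lemma q_transition (G : full_sub (profinite_ext U)) (n : nat) :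
  isomorphic (q n (filt_incl_ext n.+1 (q n.+1 G))) (q n G).
Proof.
have [phi [phi_bij phi_nat]] := q_adj n.
have [psi [psi_bij psi_nat]] := q_adj n.+1.
pose Q := q n.+1 G; pose iQ := filt_incl_ext n.+1 Q.
pose j (x : full_sub (Un n)) : full_sub (Un n.+1) :=
  exist _ (sval x) (filt_mono filt (svalP x)).
have phiE x y (h : chom (q n x) y) :
    phi x y h = fmor (filt_incl_ext n) h \oc phi x _ (idm _).
  by rewrite -[in LHS](ccompm1 h) -[in LHS](ccompm1 (_ \oc _)) -(fmor1 (q n))
    phi_nat ccompm1.
have psiE x y (h : chom (q n.+1 x) y) :
    psi x y h = fmor (filt_incl_ext n.+1) h \oc psi x _ (idm _).
  by rewrite -[in LHS](ccompm1 h) -[in LHS](ccompm1 (_ \oc _)) -(fmor1 (q n.+1))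
    psi_nat ccompm1.
pose eta : chom G iQ := psi G Q (idm Q).
(* every morphism out of [iQ] into a group of [Un n] is determined by its
   restriction along [eta] *)
have eta_inj (y : full_sub (Un n)) (a b : chom iQ (filt_incl_ext n y)) :
    a \oc eta = b \oc eta -> a = b.
  have [a' ->] := discrete_fmor_full a; have [b' ->] := discrete_fmor_full b.
  move=> ab; suff -> : a' = b' by [].
  have [psi' psiK _] := psi_bij G (j y).
  apply: (can_inj psiK); rewrite (psiE G (j y) a') (psiE G (j y) b').
  exact: ab.
have [u uE] : exists u : chom Q (j (q n G)),
    fmor (filt_incl_ext n.+1) u \oc eta = phi G _ (idm (q n G)).
  have [psi' _ psiK'] := psi_bij G (j (q n G)).
  exists (psi' (phi G _ (idm (q n G)))).
  by rewrite /eta -psiE psiK'.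
pose w : chom iQ (filt_incl_ext n (q n G)) := fmor (filt_incl_ext n.+1) u.
have wE : w \oc eta = phi G _ (idm (q n G)) by exact: uE.
have [phi' phiK phiK'] := phi_bij iQ (q n G).
pose v : chom (q n iQ) (q n G) := phi' w.
have phiv : phi _ _ v = w by exact: phiK'.
exists v, (fmor (q n) eta); split.
  have [phi'' phiK2 _] := phi_bij iQ (q n iQ); apply: (can_inj phiK2).
  apply: eta_inj.
  have e1 : phi iQ (q n iQ) (fmor (q n) eta \oc v) =
      fmor (filt_incl_ext n) (fmor (q n) eta) \oc w.
    by rewrite phiE fmorM -ccompA -phiE phiv.
  rewrite e1 -ccompA wE -phiE.
  by rewrite -[in LHS](ccomp1m (fmor (q n) eta)) -[in LHS](ccomp1m (idm _))
    phi_nat fmor1 ccomp1m.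
have [phi'' phiK2 _] := phi_bij G (q n G); apply: (can_inj phiK2).
rewrite -[v]ccomp1m phi_nat fmor1 ccomp1m phiv; exact: wE.
Qed.

Lemma pi0_limit_map_subproof (A : pi0 (full_sub (profinite_ext U))) (n : nat) :
  pi0_transition (pi0_map (q n.+1) A) = pi0_map (q n) A.
Proof.
have [G ->] := pi0_ind A; rewrite /pi0_transition !pi0_mapE.
exact/pi0_class_eq/q_transition.
Qed.

Definition pi0_limit_map (A : pi0 (full_sub (profinite_ext U))) : pi0_limit :=
  exist _ (fun n => pi0_map (q n) A) (pi0_limit_map_subproof A).

End Limit.

(* Main.v *)
(* A group [G] of the profinite extension is separated by its reflections
   [G -> q n G]: open normal subgroups of a profinite group intersect trivially,
   and every quotient of [G] in [U] already lies in some [Un n].  By compactness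
   [G] is then the inverse limit of the tower of its reflections.  If [q n G]
   and [q n H] are isomorphic for all [n], the finite sets of isomorphisms
   between them form an inverse system, so Konig's lemma gives a compatible
   family of isomorphisms, which passes to the limit.  Conversely, a point of
   [lim pi0 (Un n)] is represented by a tower of finite groups [K n] whose
   transition maps are reflections; its inverse limit [L] is topologically
   generated by [r] elements (Konig again, on generating [r]-tuples), and since
   every continuous map from [L] to a finite group factors through some [K n],
   the projection [L -> K n] is the reflection of [L]. *)
From HB Require Import structures.
From mathcomp Require Import all_boot all_fingroup.
From mathcomp Require Import all_classical.
From mathcomp Require Import topology.
Require Import Defs.

Set Implicit Arguments.
Unset Strict Implicit.
Unset Printing Implicit Defensive.

Local Open Scope classical_set_scope.
Local Open Scope group_scope.

(** * Compactness *)

(** The sets [F i] are a base of a proper filter, and a cluster point of it lies in each of them by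
    closedness. *)
Lemma compact_directed (X : topologicalType) (I : Type) (D : set I)
    (F : I -> set X) :
  compact [set: X] -> D !=set0 ->
  (forall i, D i -> closed (F i)) ->
  (forall i j, D i -> D j -> exists2 k, D k & F k `<=` F i `&` F j) ->
  (forall i, D i -> F i !=set0) ->
  exists x, forall i, D i -> F i x.
Proof.
move=> cX [i0 Di0] Fc Fd F0.
have FF : ProperFilter (filter_from D F).
  apply: filter_from_proper => //; apply: filter_from_filter.
    by exists i0.
  exact: Fd.
have [|x [_ xF]] := cX _ FF; first by exists i0.
exists x => i Di; apply: Fc => // B xB.
by apply: xF => //; exists i.
Qed.

Lemma compact_nested (X : topologicalType) (F : nat -> set X) :
  compact [set: X] -> (forall n, closed (F n)) ->
  (forall n, F n.+1 `<=` F n) -> (forall n, F n !=set0) ->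
  exists x, forall n, F n x.
Proof.
move=> cX Fc Fd F0.
have Fle m n : (m <= n)%N -> F n `<=` F m.
  elim: n => [|n IHn]; first by rewrite leqn0 => /eqP->.
  rewrite leq_eqVlt => /orP[/eqP-> //|]; rewrite ltnS => /IHn.
  by move=> FnF; apply: subset_trans FnF; exact: Fd.
have [i j _ _|x xF] := @compact_directed X nat setT F cX (ex_intro _ 0%N I)
    (fun n _ => Fc n) _ (fun n _ => F0 n).
- exists (maxn i j) => // x Fx; split; apply: Fle Fx.
    exact: leq_maxl.
  exact: leq_maxr.
- by exists x => n; exact: xF.
Qed.

Section DiscreteCodomain.
Variables (X : topologicalType) (K : choiceType).
Implicit Types f : X -> discrete_topology K.

Lemma discrete_preimage_open f (A : set K) : continuous f -> open (f @^-1` A).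
Proof. by move/continuousP; apply; exact: discrete_open. Qed.

Lemma discrete_preimage_closed f (A : set K) :
  continuous f -> closed (f @^-1` A).
Proof. by move/continuous_closedP; apply; exact: discrete_closed. Qed.

Lemma locally_constant_continuous f :
  (forall x, nbhs x [set y | f y = f x]) -> continuous f.
Proof.
move=> fP x; apply/(@discrete_cvg (discrete_topology K)).
by apply: filterS (fP x) => y.
Qed.

End DiscreteCodomain.

Section DiscreteProduct.
Variable T : nat -> finType.
Local Notation X := (prod_topology (fun n => discrete_topology (T n))).

Lemma discrete_proj_continuous n :
  continuous (fun x : X => x n : discrete_topology (T n)).
Proof. exact: (@proj_continuous nat (fun n => discrete_topology (T n))). Qed.

Lemma discrete_prod_compact : compact [set: X].
Proof.
have := @tychonoff nat (fun n => discrete_topology (T n)) (fun=> setT).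
rewrite (_ : [set f | _] = setT); last by apply/seteqP; split.
by apply=> n; apply: finite_compact; exact: (@finite_finset (T n) setT).
Qed.

Lemma closed_adjacent n (R : T n -> T n.+1 -> Prop) :
  closed [set x : X | R (x n) (x n.+1)].
Proof.
rewrite -openC openE => x nRx.
have xN i : nbhs x [set y : X | y i = x i].
  apply: open_nbhs_nbhs; split=> //.
  apply: (discrete_preimage_open [set x i]).
  exact: discrete_proj_continuous.
by apply: filterS2 (xN n) (xN n.+1) => y /= yn yn1; rewrite /= yn yn1.
Qed.

End DiscreteProduct.

Section Konig.
Variables (T : nat -> finType) (P : forall n, T n -> Prop).
Variable R : forall n, T n -> T n.+1 -> Prop.
Arguments P : clear implicits.
Arguments R : clear implicits.
Hypothesis P_ex : forall n, exists x, P n x.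
Hypothesis P_down :
  forall n y, P n.+1 y -> exists2 z, P n z & R n z y.

(** Entries below [k] come from descending with [P_down]; those above are arbitrary choices from
    [P_ex]. *)
Lemma konig_prefix (k : nat) (y : T k) : P k y ->
  exists x : forall n, T n, [/\ x k = y, forall n, P n (x n) &
    forall n, (n < k)%N -> R n (x n) (x n.+1)].
Proof.
elim: k y => [|k IHk] y Py.
  exists (dfwith (fun n => sval (cid (P_ex n))) 0%N y); split=> //.
    by rewrite dfwithin.
  by move=> n; case: dfwithP => // i _; case: cid.
have [z /IHk[x [xk xP xR]] Rzy] := P_down Py.
exists (dfwith x k.+1 y); split; first by rewrite dfwithin.
  by move=> n; case: dfwithP.
move=> n; rewrite ltnS leq_eqVlt => /orP[/eqP ->|nk].
  by rewrite dfwithin dfwithout ?xk// gtn_eqF.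
rewrite !dfwithout; first exact: xR.
  by rewrite eqSS gtn_eqF.
by rewrite gtn_eqF// ltnW.
Qed.

(** Sequences related up to level [k] form nested nonempty closed subsets [F k] of a compact product
    of finite sets. *)
Lemma konig : exists x : forall n, T n,
  forall n, P n (x n) /\ R n (x n) (x n.+1).
Proof.
pose X := prod_topology (fun n => discrete_topology (T n)).
pose F k : set X := [set x | (forall n, P n (x n)) /\
  forall n, (n < k)%N -> R n (x n) (x n.+1)].
have [|k|k x [xP xR]|k|x xF] := @compact_nested X F.
- exact: discrete_prod_compact.
- rewrite (_ : F k = \bigcap_n ((fun x : X => x n) @^-1` P n) `&`
    \bigcap_(n in [set n | (n < k)%N]) [set x : X | R n (x n) (x n.+1)]).
    apply: closedI; apply: closed_bigI => n _; last exact: closed_adjacent.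
    apply: (discrete_preimage_closed (A := P n) (f := fun x : X => x n)).
    exact: discrete_proj_continuous.
  by apply/seteqP; split=> x [xP xR]; split=> n *; solve [exact: xP|exact: xR].
- by split=> // n nk; apply: xR; rewrite ltnS ltnW.
- have [y /konig_prefix[x [_ ? ?]]] := P_ex k; by exists x; split.
- exists x => n; have [xP xR] := xF n.+1; split=> //; exact: xR.
Qed.

End Konig.

(** * Open normal subgroups of profinite groups *)

(* The quasicomponent [Q] of [x] is connected: a separation of [Q] extends to
   disjoint open sets [U] and [V], and some clopen [E] with [Q `<=` E] lies in
   [U `|` V], so that [E `&` U] is again clopen. *)
Lemma totally_disconnected_zero_dimensional (X : topologicalType) :
  compact [set: X] -> hausdorff_space X -> totally_disconnected [set: X] ->
  zero_dimensional X.
Proof.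
move=> cX hX tdX x y xy; apply: contrapT => sep.
have sepP C : clopen C -> C x -> C y.
  by move=> cC Cx; apply: contrapT => Cy; apply: sep; exists C.
pose D := [set C : set X | clopen C /\ C x].
pose Q := \bigcap_(C in D) C.
have Qx : Q x by move=> C [].
have Qy : Q y by move=> C [cC Cx]; exact: sepP.
have Qc : closed Q by apply: closed_bigI => C [[]].
(* By compactness: otherwise the directed closed sets [C] minus [O] would share a point, which would
   lie in [Q] but not in [O]. *)
have Qin O : open O -> Q `<=` O -> exists2 C, D C & C `<=` O.
  move=> oO QO; apply: contrapT => nC.
  have [||C C' [cC Cx] [cC' Cx']|C DC|z zP] :=
    @compact_directed X _ D (fun C => C `\` O) cX.
  - by exists setT; split=> //; exact: clopenT.
  - by move=> C [[_ cC] _]; apply: closedI => //; exact: open_closedC.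
  - exists (C `&` C'); first by split; [exact: clopenI|split].
    by move=> z [[? ?] ?].
  - apply/set0P/eqP; rewrite setD_eq0 => CO; apply: nC; by exists C.
  - have DT : D setT by split=> //; exact: clopenT.
    have [_ nOz] := zP _ DT; apply: nOz; apply: QO => C DC.
    by have [] := zP _ DC.
suff Qcon : connected Q.
  have : connected_component [set: X] x y by exists Q.
  by rewrite tdX// => yx; move/eqP: xy; apply.
move=> B [b Bb] [O oO BO] [C cC BC].
have Bc : closed B by rewrite BC; exact: closedI.
have [|W BW WA] := compact_normal hX cX Bc (_ : set_nbhs B (~` (Q `\` B))).
  apply/set_nbhsP; exists (~` (Q `\` B)); split=> //; last by move=> z Bz [].
  rewrite BO setDIr setDv set0U; apply: closed_openC.
  by apply: closedI => //; exact: open_closedC.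
have /set_nbhsP[U [oU BU UW]] := BW.
have [|z Qz|E [[oE cE] Ex] EUV] := Qin (U `|` ~` closure W).
- by apply: openU => //; apply: closed_openC; exact: closed_closure.
- have [Bz|nBz] := pselect (B z); first by left; exact: BU.
  by right => /WA; apply.
have EU : clopen (E `&` U).
  split; first exact: openI.
  rewrite (_ : E `&` U = E `&` closure W).
    by apply: closedI => //; exact: closed_closure.
  apply/seteqP; split=> z [Ez Uz]; split=> //.
    exact/subset_closure/UW.
  by case: (EUV z Ez).
(* If [x] were outside this clopen set, its complement would contain all of [Q], yet it misses
   [b]. *)
have [EUx|nEUx] := pselect ((E `&` U) x); last first.
  have Qb : Q b by move: Bb; rewrite BO => -[].
  have [] : (~` (E `&` U)) b by apply: Qb; split=> //; exact: clopenC.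
  by split; [exact: Qb|exact: BU].
apply/seteqP; split=> z; first by rewrite BO => -[].
move=> Qz; apply: contrapT => nBz.
have [_ Uz] : (E `&` U) z by apply: Qz.
by apply: (WA z) => //; exact/subset_closure/UW.
Qed.

Lemma continuous_mulg (X : topologicalType) (G : topologicalGroupType)
    (f g : X -> G) (x : X) :
  {for x, continuous f} -> {for x, continuous g} ->
  {for x, continuous (fun y => f y * g y)}.
Proof.
move=> fx gx.
exact: (cvg_comp2 (h := fun a b => a * b) fx gx
  (@mulg_continuous G (f x, g x))).
Qed.

Lemma nbhs_translate (G : topologicalGroupType) (N : set G) (x : G) :
  nbhs 1 N -> nbhs x [set y | N (x^-1 * y)].
Proof.
have xy : (fun y => x^-1 * y) @ x --> x^-1 * x.
  exact: (continuous_mulg (@cvg_cst _ _ _ _ _) (@cvg_id _ (nbhs x))).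
by move=> N1; apply: xy; rewrite mulVg.
Qed.

Lemma open_subgroup (G : topologicalGroupType) (N : set G) :
  is_subgroup N -> nbhs 1 N -> open N.
Proof.
move=> [N1 NM] N1n; rewrite openE => x Nx.
have NV z : N z -> N z^-1 by move=> Nz; rewrite -(mul1g z^-1); exact: NM.
apply: filterS (nbhs_translate x N1n) => y /NV Nxy.
by rewrite -(mulKVg x y) -[x^-1 * y]invgK; exact: NM.
Qed.

(* The set of all [n] that can be deleted from any product without leaving or
   entering the clopen set [C] is normal, and open by compactness. *)
Lemma profinite_residual (G : profiniteGroupType) (x : G) :
  x <> 1 -> exists2 N, open_normal N & ~ N x.
Proof.
move=> x1; have zG := totally_disconnected_zero_dimensional
  (@profinite_compact G) (@profinite_hausdorff G)
  (@profinite_totally_disconnected G).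
have [|C [[Co Cc] C1 Cx]] := zG 1 x; first by apply/eqP => /esym.
pose N := [set n : G | forall a b, C (a * n * b) <-> C (a * b)].
exists N; last by move=> /(_ 1 1); rewrite !mul1g !mulg1 => -[_ /(_ C1)].
have NM n m : N n -> N m -> N (n * m^-1).
  move=> Nn Nm a b.
  by rewrite mulgA -(Nm (a * n * m^-1)) mulgKV; exact: Nn.
have N1 : N 1 by move=> a b; rewrite mulg1.
split; last first.
  split=> // n y Nn a b; rewrite conjgE.
  by rewrite (_ : _ * b = a * y^-1 * n * (y * b)) ?Nn !mulgA ?mulgKV.
apply: (@open_subgroup G) => //.
have CP (X : topologicalType) (f : X -> G) (p : X) : {for p, continuous f} ->
    \forall y \near p, C (f y) <-> C (f p).
  move=> fp; have [Cp|nCp] := pselect (C (f p)).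
    have : nbhs p (f @^-1` C) by apply: fp; exact: open_nbhs_nbhs.
    by apply: filterS.
  have : nbhs p (f @^-1` (~` C)).
    by apply: fp; apply: open_nbhs_nbhs; split=> //; exact: closed_openC.
  by apply: filterS.
(* The tube lemma: it suffices to treat [n] near 1 jointly with pairs near a fixed [(a, b)], where
   both memberships are locally constant. *)
have /compact_near_coveringP cG2 := compact_setX (@profinite_compact G)
  (@profinite_compact G).
pose P (n : G) (p : G * G) := C (p.1 * n * p.2) <-> C (p.1 * p.2).
suff : \forall n \near (1 : G), [set: G] `*` [set: G] `<=` P n.
  by apply: filterS => n nP a b; exact: (nP (a, b)).
apply: cG2 => -[a b] _.
pose X : topologicalType := ((G * G) * G)%type.
have c1 : {for ((a, b), 1), continuous (fun z : X => z.1.1)}.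
  exact: (cvg_comp _ _ cvg_fst cvg_fst).
have c2 : {for ((a, b), 1), continuous (fun z : X => z.1.2)}.
  exact: (cvg_comp _ _ cvg_fst cvg_snd).
have c3 : {for ((a, b), 1), continuous (fun z : X => z.2)} by exact: cvg_snd.
have := CP _ _ _ (continuous_mulg c1 c2).
have := CP _ _ _ (continuous_mulg (continuous_mulg c1 c3) c2).
by apply: filterS2 => z /=; rewrite /P mulg1 => -> ->.
Qed.

(** * Surjective homomorphisms and reflections *)

Lemma surj_hom1 (G H : groupType) (f : G -> H) : surj_hom f -> f 1 = 1.
Proof. by move=> [fM _]; apply: (mulgI (f 1)); rewrite mulg1 -fM mulg1. Qed.

Lemma surj_homV (G H : groupType) (f : G -> H) :
  surj_hom f -> {morph f : x / x^-1}.
Proof.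
move=> fS x; apply: (mulgI (f x)); rewrite mulgV -fS.1 mulgV.
exact: surj_hom1.
Qed.

(** Any set-theoretic section of [p] will do: [f] does not see the choice of preimage, which makes
    the composite multiplicative. *)
Lemma surj_hom_quotient (G H K : groupType) (p : G -> H) (f : G -> K) :
  surj_hom p -> surj_hom f -> (forall x y, p x = p y -> f x = f y) ->
  exists2 g : H -> K, surj_hom g & f = g \o p.
Proof.
move=> [pM pS] [fM fS] pf; have [s sK] := choice pS.
have gp x : f (s (p x)) = f x by apply: pf; rewrite sK.
exists (f \o s); last by apply/funext => x /=; rewrite gp.
split=> [x y|z]; last by have [x <-] := fS z; exists (p x); rewrite /= gp.
by rewrite /= -fM; apply: pf; rewrite pM !sK.
Qed.

Definition group_iso (G H : groupType) : Prop :=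
  exists2 f : G -> H, surj_hom f & injective f.

Lemma conj_category_isomorphic (T : Type) (grp : T -> groupType)
    (mor : forall G H : T, (grp G -> grp H) -> Prop)
    (mor_hom : forall G H f, @mor G H f -> surj_hom f)
    (mor_id : forall G, @mor G G idfun)
    (mor_comp : forall G H K (g : grp H -> grp K) (f : grp G -> grp H),
       mor _ _ g -> mor _ _ f -> mor _ _ (g \o f))
    (G H : conj_category mor_hom mor_id mor_comp)
    (f : grp G -> grp H) (g : grp H -> grp G) :
  mor _ _ f -> mor _ _ g -> g \o f = idfun -> f \o g = idfun ->
  isomorphic G H.
Proof.
move=> mf mg gf fg; exists (class_hom mf), (class_hom mg).
by split; apply: eq_exist; rewrite /= (conj_class_comp mor_hom)// ?gf ?fg.
Qed.

(** Inverse classes have representatives that are inverse only up to conjugation, but then [g \o f]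
    is an inner automorphism, so [f] is injective. *)
Lemma isomorphic_group_iso (V : FinGrp -> Prop) (x y : full_sub V) :
  isomorphic x y <-> group_iso (sval x) (sval y).
Proof.
split=> [[A [B [BA _]]]|[f fS fI]].
  have [f [mf eA]] := conj_hom_ind A; have [g [mg eB]] := conj_hom_ind B.
  have [h gfE] : conj_class idfun (g \o f).
    have /= := congr1 sval BA; rewrite eA eB /= => <-.
    by exists g, f; split=> //; exact: conj_class_refl.
  exists f => // a b fab; apply: (conjg_inj h).
  have := congr1 (@^~ a) gfE; have /= := congr1 (@^~ b) gfE.
  by rewrite /= fab => -> ->.
have [g mg gf] := surj_hom_quotient fS (fin_mor_id (sval x)) fI.
have fg : f \o g = idfun.
  apply/funext => z; have [w <-] := fS.2 z.
  by rewrite /= -[g _]/((g \o f) w) -gf.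
exact: (@conj_category_isomorphic _ _ _ _ _ _ (sval x) (sval y) f g fS mg).
Qed.

(* The unit of the reflection of [G] into [V]: a quotient map with the smallest
   kernel.  Inclusion of kernels replaces factorization, so that no conjugation
   is involved. *)
Definition is_reflection (V : FinGrp -> Prop) (G : profiniteGroupType)
    (K : finGroupType) (p : G -> discrete_group K) : Prop :=
  [/\ V K, prof_mor p &
    forall (L : finGroupType) (f : G -> discrete_group L), V L -> prof_mor f ->
      forall x y, p x = p y -> f x = f y].

Lemma is_reflection_iso (V : FinGrp -> Prop) (G : profiniteGroupType)
    (K L : finGroupType) (p : G -> discrete_group K)
    (p' : G -> discrete_group L) :
  is_reflection V p -> is_reflection V p' -> group_iso K L.
Proof.
move=> [VK pm pU] [VL pm' pU'].
have [f fS pE] := surj_hom_quotient pm.1 pm'.1 (pU _ _ VL pm').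
exists f => // a b; have [x <-] := pm.1.2 a; have [y <-] := pm.1.2 b.
by move=> fab; apply: (pU' _ _ VK pm); rewrite pE.
Qed.

(** The map [p] represents the unit of the adjunction, through which every class from [G] to a group
    of [V] factors by naturality. *)
Lemma left_adjoint_reflection (U V : FinGrp -> Prop)
    (VU : forall G, V G -> U G)
    (q : functor (full_sub (profinite_ext U)) (full_sub V))
    (G : full_sub (profinite_ext U)) :
  is_left_adjoint q (incl_ext VU) ->
  exists p : sval G -> discrete_group (sval (q G)), is_reflection V p.
Proof.
move=> [phi [phi_bij phi_nat]].
pose eta := phi G (q G) (idm _).
have phiE y (h : chom (q G) y) : phi G y h = (fmor (incl_ext VU) h \oc eta)%cat.
  rewrite /eta -[in LHS](ccompm1 h) -[in LHS](ccompm1 (_ \oc _)%cat) -(fmor1 q).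
  by rewrite phi_nat ccompm1.
have [p [pm etaE]] := conj_hom_ind eta.
exists p; split=> [||L f VL fm x y pxy]; [exact: svalP|exact: pm|].
pose y' : full_sub V := exist _ L VL.
have [phi' _ phiK] := phi_bij G y'.
pose fh : chom G (incl_ext VU y') := class_hom fm.
have := phiK fh; rewrite phiE.
have [g [gm ->]] := conj_hom_ind (phi' fh).
rewrite etaE => /(congr1 sval) /= fE.
(* The composite class contains [f] itself, so [f] is a conjugate of [g] after a conjugate of [p],
   hence constant on the fibres of [p]. *)
have : conj_class f f by exact: conj_class_refl.
rewrite -fE => -[g' [p' [[a ->] [b ->] ->]]] /=.
by rewrite /= pxy.
Qed.

Lemma surj_card_inj (S T : finType) (f : S -> T) :
  (forall y, exists x, f x = y) -> #|S| = #|T| -> injective f.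
Proof.
move=> /choice[g gK] ST; have gI := can_inj gK.
have [g' gK' g'K] : bijective g by apply: inj_card_bij => //; rewrite ST.
by move=> x y; rewrite -(g'K x) -(g'K y) !gK => ->.
Qed.

(* Generation is expressed through [is_subgroup] rather than [<<_>>] so that it
   transfers along surjections by taking preimages. *)
Definition generates (r : nat) (H : groupType) (s : 'I_r -> H) : Prop :=
  forall A : set H, is_subgroup A -> (forall i, A (s i)) -> A = setT.

Lemma r_generatedP (r : nat) (H : finGroupType) :
  r_generated r H -> exists s : {ffun 'I_r -> H}, generates s.
Proof.
(* The default [1] pads the tuple when [B] has fewer than [r] elements. *)
move=> [B [Br BH]]; exists [ffun i : 'I_r => nth 1 (enum B) i] => A [A1 AM] sA.
have gA : group_set [set x | `[< A x >]]%SET.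
  apply/group_setP; split=> [|x y]; rewrite !inE//= => Ax Ay.
  by rewrite -[y]invgK -[y^-1]mul1g; apply: (AM) => //; exact: AM.
have BA : <<B>> \subset Group gA.
  rewrite gen_subG; apply/fintype.subsetP => x xB; rewrite inE; apply/asboolP.
  have xs : (index x (enum B) < r)%N.
    by rewrite (leq_trans _ Br)// cardE index_mem mem_enum.
  have := sA (Ordinal xs); rewrite ffunE /= nth_index//.
  by rewrite mem_enum.
rewrite -subTset => x _; move: BA; rewrite BH => /fintype.subsetP/(_ x).
by rewrite !inE => /(_ isT).
Qed.

Lemma preim_subgroup (H K : groupType) (f : H -> K) (A : set K) :
  surj_hom f -> is_subgroup A -> is_subgroup (f @^-1` A).
Proof.
move=> fS [A1 AM]; split=> /= [|x y Ax Ay]; first by rewrite (surj_hom1 fS).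
by rewrite fS.1 (surj_homV fS); exact: AM.
Qed.

Lemma image_subgroup (H K : groupType) (f : H -> K) (A : set H) :
  surj_hom f -> is_subgroup A -> is_subgroup (f @` A).
Proof.
move=> fS [A1 AM]; split; first by exists 1 => //; exact: surj_hom1.
move=> _ _ [x Ax <-] [y Ay <-]; exists (x * y^-1); first exact: AM.
by rewrite fS.1 surj_homV.
Qed.

Lemma generates_image (r : nat) (H K : groupType) (f : H -> K) (s : 'I_r -> H) :
  surj_hom f -> generates s -> generates (f \o s).
Proof.
move=> fS gs A sgA sA; rewrite -subTset => y _; have [x <-] := fS.2 y.
suff : (f @^-1` A) x by [].
by rewrite (gs _ (preim_subgroup fS sgA)).
Qed.

Lemma smallest_subgroup (H : groupType) (A : set H) :
  is_subgroup (smallest (@is_subgroup H) A).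
Proof.
split=> [B [[]]//|x y Ax Ay B AB].
by apply: AB.1.2; [exact: Ax|exact: Ay].
Qed.

Lemma kernel_open_normal (H : profiniteGroupType) (K : finGroupType)
  (f : H -> discrete_group K) : prof_mor f -> open_normal [set x | f x = 1].
Proof.
move=> [fS fC]; split; first exact: (discrete_preimage_open [set 1] fC).
split=> [|x y /= fx]; last first.
  by rewrite conjgE !fS.1 fx (surj_homV fS) mul1g mulVg.
split=> /= [|x y fx fy]; first exact: surj_hom1.
by rewrite fS.1 (surj_homV fS) fx fy mulgV.
Qed.

Lemma open_kernel_continuous (G : profiniteGroupType) (K : finGroupType)
    (f : G -> discrete_group K) :
  surj_hom f -> open [set x | f x = 1] -> continuous f.
Proof.
move=> fS fo; apply: (@locally_constant_continuous G K f) => x.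
have : nbhs 1 [set x | f x = 1].
  by apply: open_nbhs_nbhs; split=> //; exact: surj_hom1.
move=> /(nbhs_translate x); apply: filterS => y /= fxy.
by apply: (mulgI (f x)^-1); rewrite mulVg -(surj_homV fS) -fS.1.
Qed.

(** * Towers of finite quotients *)

(** If every fibre through [x] left the open set [W], the nested closed traces outside [W] would
    share a point by compactness, and separation would make it [x]. *)
Lemma tower_nbhs (X : topologicalType) (K : nat -> choiceType)
    (p : forall n, X -> discrete_topology (K n)) :
  compact [set: X] -> (forall n, continuous (p n)) ->
  (forall n x y, p n.+1 x = p n.+1 y -> p n x = p n y) ->
  (forall x y, (forall n, p n x = p n y) -> x = y) ->
  forall x O, nbhs x O -> exists n, forall y, p n y = p n x -> O y.
Proof.
move=> cX pC pS pI x O /nbhs_interior; rewrite nbhsE => -[W [oW Wx] WO].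
apply: contrapT => nO.
have [||n|y yP] := @compact_nested X
    (fun n => [set y | p n y = p n x] `&` ~` W) cX.
- move=> n; apply: closedI; last exact: open_closedC.
  exact: (discrete_preimage_closed (A := [set p n x]) (pC n)).
- by move=> n y [/pS ? ?].
- apply: contrapT => nF; apply: nO; exists n => y yx.
  apply: interior_subset; apply: WO; apply: contrapT => nWy.
  by apply: nF; exists y.
- have [_ nWy] := yP 0%N; apply: nWy.
  by rewrite (pI y x) // => n; have [] := yP n.
Qed.

(** The transition maps stay implicit: the condition on fibres makes [p n] factor through [p n.+1].
    By compactness such a [G] is the inverse limit of the [K n]. *)
Definition is_tower (G : profiniteGroupType) (K : nat -> finGroupType)
    (p : forall n, G -> discrete_group (K n)) : Prop :=
  [/\ forall n, prof_mor (p n),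
      forall n x y, p n.+1 x = p n.+1 y -> p n x = p n y &
      forall x y, (forall n, p n x = p n y) -> x = y].

(** The point [h x] is common to nested closed fibres, nonempty because each [p' n] is onto. The
    last hypothesis is compatibility of the [f n] with the unnamed transition maps. *)
Lemma tower_map (G H : profiniteGroupType) (K L : nat -> finGroupType)
    (p : forall n, G -> discrete_group (K n))
    (p' : forall n, H -> discrete_group (L n))
    (f : forall n, K n -> L n) :
  is_tower p -> is_tower p' ->
  (forall n, {morph f n : x y / x * y}) ->
  (forall n x y, f n.+1 (p n.+1 x) = p' n.+1 y -> f n (p n x) = p' n y) ->
  exists h : G -> H, [/\ {morph h : x y / x * y}, continuous h &
    forall n x, p' n (h x) = f n (p n x)].
Proof.
move=> [pm pS pI] [pm' pS' pI'] fM fS.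
have /choice[h hP] x : exists y : H, forall n, p' n y = f n (p n x).
  apply: (compact_nested (F := fun n => [set y | p' n y = f n (p n x)])).
  - exact: profinite_compact.
  - move=> n; apply: (discrete_preimage_closed (A := [set f n (p n x)])).
    exact: (pm' n).2.
  - by move=> n y /esym/fS/esym.
  - by move=> n; have [y] := (pm' n).1.2 (f n (p n x)); exists y.
exists h; split=> // [x y|x O].
  by apply: pI' => n; rewrite (pm' n).1.1 !hP (pm n).1.1 fM.
move=> /(tower_nbhs (@profinite_compact H) (fun n => (pm' n).2) pS' pI')[n nO].
have : nbhs x (p n @^-1` [set p n x]).
  apply: open_nbhs_nbhs; split=> //.
  exact: discrete_preimage_open (pm n).2.
by apply: filterS => y /= yx; apply: nO; rewrite !hP yx.
Qed.

Section TowerIso.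
Variables (G H : profiniteGroupType) (K L : nat -> finGroupType).
Variables (p : forall n, G -> discrete_group (K n)).
Variables (p' : forall n, H -> discrete_group (L n)).
Variable V : nat -> FinGrp -> Prop.
Hypotheses (p_tower : is_tower p) (p_tower' : is_tower p').
Hypothesis p_refl : forall n, is_reflection (V n) (p n).
Hypothesis VL : forall n, V n (L n).
Hypothesis KL : forall n, group_iso (K n) (L n).

(** For Konig's lemma an isomorphism must descend from level [n.+1] to [n]: followed by
    [L n.+1 -> L n] it maps onto a group of [V n], so the reflection [p n] factors it through
    [K n]. *)
Lemma tower_compatible_isos : exists f : forall n, K n -> L n,
  (forall n, surj_hom (f n) /\ injective (f n)) /\
  forall n x y, f n.+1 (p n.+1 x) = p' n.+1 y -> f n (p n x) = p' n y.
Proof.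
have [pm pS pI] := p_tower; have [pm' pS' pI'] := p_tower'.
have [||f fP] := @konig (fun n => {ffun K n -> L n})
  (fun n f => @surj_hom (K n) (L n) f /\ injective f)
  (fun n f f' => forall x y, f' (p n.+1 x) = p' n.+1 y -> f (p n x) = p' n y).
- move=> n; have [f fS fI] := KL n; exists (finfun f).
  by rewrite (_ : finfun f = f :> (_ -> _))//; apply/funext => x; rewrite ffunE.
- move=> n f' [fS' fI'].
  have [l lS lE] := surj_hom_quotient (pm' n.+1).1 (pm' n).1 (@pS' n).
  have lfm : @fin_mor (K n.+1) (L n) (l \o f') by apply: fin_mor_comp.
  have [_ _ pU] := p_refl n.
  have gm : @prof_mor G (discrete_group (L n)) (l \o f' \o p n.+1).
    exact: prof_mor_comp (discrete_prof_mor lfm) (pm n.+1).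
  have [f fS fE] := surj_hom_quotient (pm n).1 gm.1 (pU _ _ (VL n) gm).
  exists (finfun f).
    rewrite (_ : finfun f = f :> (_ -> _)); last first.
      by apply/funext => x; rewrite ffunE.
    (* The induced map is onto between groups of equal order, hence injective. *)
    split=> //; apply: surj_card_inj; first exact: fS.2.
    have [k [_ /choice[g gK]] kI] := KL n; apply: bij_eq_card.
    by exists g => // x; apply: kI; rewrite gK.
  move=> x y; rewrite ffunE -[f _]/((f \o p n) x) -fE lE /= => ->.
  by [].
- exists (fun n x => f n x); split=> n; first by case: (fP n).
  by case: (fP n).
Qed.

Lemma tower_isomorphic : @isomorphic ProfGrp G H.
Proof.
have [f [fP fR]] := tower_compatible_isos.
have [_ _ pI] := p_tower; have [_ _ pI'] := p_tower'.
have gP n : exists2 g : L n -> K n, surj_hom g & cancel (f n) g.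
  have [fS fI] := fP n.
  have [g gS gf] := surj_hom_quotient fS (fin_mor_id (K n)) fI.
  by exists g => // x; rewrite -[g _]/((g \o f n) x) -gf.
pose g n := sval (cid2 (gP n)).
have gS n : surj_hom (g n) by rewrite /g; case: cid2.
have fK n : cancel (f n) (g n) by rewrite /g; case: cid2.
have gK n : cancel (g n) (f n).
  by move=> z; have [x <-] := (fP n).1.2 z; rewrite fK.
have [h [hM hC hP]] := tower_map p_tower p_tower' (fun n => (fP n).1.1) fR.
have [|h' [hM' hC' hP']] := tower_map p_tower' p_tower (fun n => (gS n).1).
  (* Compatibility of the inverses is that of the [f n] read backwards. *)
  by move=> n x y gxy; rewrite -(fR n y x) ?fK// -gxy gK.
have hh' : h \o h' = idfun.
  by apply/funext => x; apply: pI' => n; rewrite /= hP hP' gK.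
have h'h : h' \o h = idfun.
  by apply/funext => x; apply: pI => n; rewrite /= hP' hP fK.
apply: (@conj_category_isomorphic _ _ _ _ _ _ G H h h') => //.
  by split=> //; split=> // y; exists (h' y); rewrite -[LHS]/((h \o h') y) hh'.
by split=> //; split=> // y; exists (h y); rewrite -[LHS]/((h' \o h) y) h'h.
Qed.

End TowerIso.

(** * Inverse limits of finite groups *)

(* [tS] is a parameter only so that the group structure can be canonical. *)
Definition invlim (G : nat -> finGroupType) (t : forall n, G n.+1 -> G n)
    (tS : forall n, surj_hom (t n)) : Type :=
  {x : forall n, G n | forall n, t n (x n.+1) = x n}.

Section InverseLimit.
Variables (G : nat -> finGroupType) (t : forall n, G n.+1 -> G n).
Arguments t : clear implicits.
Hypothesis tS : forall n, surj_hom (t n).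
Local Notation L := (invlim tS).

Definition invlim_proj (n : nat) (x : L) : discrete_group (G n) := sval x n.
Local Notation p := invlim_proj.

Lemma invlim_projS n (x : L) : t n (p n.+1 x) = p n x.
Proof. exact: (svalP x). Qed.

Lemma invlim_ext (x y : L) : (forall n, p n x = p n y) -> x = y.
Proof.
case: x y => [x xL] [y yL] xy.
by apply/eq_exist/functional_extensionality_dep => n; exact: xy.
Qed.

Fact invlim_one_subproof n : t n 1 = 1.
Proof. exact: surj_hom1. Qed.

Fact invlim_inv_subproof (x : L) n : t n (p n.+1 x)^-1 = (p n x)^-1.
Proof. by rewrite surj_homV// invlim_projS. Qed.

Fact invlim_mul_subproof (x y : L) n :
  t n (p n.+1 x * p n.+1 y) = p n x * p n y.
Proof. by rewrite (tS n).1 !invlim_projS. Qed.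

Definition invlim_one : L := exist _ (fun n => 1) invlim_one_subproof.
Definition invlim_inv (x : L) : L :=
  exist _ (fun n => (p n x)^-1) (invlim_inv_subproof x).
Definition invlim_mul (x y : L) : L :=
  exist _ (fun n => p n x * p n y) (invlim_mul_subproof x y).

HB.instance Definition _ := gen_eqMixin L.
HB.instance Definition _ := gen_choiceMixin L.

Fact invlim_mulA : associative invlim_mul.
Proof. by move=> x y z; apply: invlim_ext => n; exact: mulgA. Qed.
Fact invlim_mul1g : left_id invlim_one invlim_mul.
Proof. by move=> x; apply: invlim_ext => n; exact: mul1g. Qed.
Fact invlim_mulg1 : right_id invlim_one invlim_mul.
Proof. by move=> x; apply: invlim_ext => n; exact: mulg1. Qed.
Fact invlim_mulVg : left_inverse invlim_one invlim_inv invlim_mul.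
Proof. by move=> x; apply: invlim_ext => n; exact: mulVg. Qed.
Fact invlim_mulgV : right_inverse invlim_one invlim_inv invlim_mul.
Proof. by move=> x; apply: invlim_ext => n; exact: mulgV. Qed.

HB.instance Definition _ := isGroup.Build L invlim_mulA invlim_mul1g
  invlim_mulg1 invlim_mulVg invlim_mulgV.

Local Notation X := (prod_topology (fun n => discrete_topology (G n))).
HB.instance Definition _ :=
  Topological.copy L (initial_topology (fun x : L => sval x : X)).

Lemma invlim_proj_continuous n : continuous (p n).
Proof.
have sC : continuous (fun x : L => sval x : X) by exact: initial_continuous.
move=> x; exact: (cvg_comp _ _ (sC x) (@discrete_proj_continuous G n (sval x))).
Qed.

(** Threads form a closed subset of the compact product; the filter is pushed there, and its cluster
    point, being a thread, comes back to [L]. *)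
Lemma invlim_compact : compact [set: L].
Proof.
pose C := \bigcap_n [set x : X | t n (x n.+1) = x n].
have cC : closed C.
  apply: closed_bigI => n _.
  exact: (@closed_adjacent G n (fun a b => t n b = a)).
move=> F FF _.
have [|x [xL xF]] := subclosed_compact cC (@discrete_prod_compact G)
  (@subsetT _ C) (fmap_proper_filter (fun x : L => sval x : X) FF).
  by apply: (@filterE _ F) => x n _; exact: (invlim_projS n x).
exists (exist _ x (fun n => xL n I)); split=> // A B FA.
move=> [_ [[O oO <-] Ox OB]].
have [|_ [[y Ay <-] Oy]] := xF (sval @` A) O _ (open_nbhs_nbhs (conj oO Ox)).
  by apply: (@filterS _ F _ A) => // y Ay; exists y.
by exists y; split=> //; exact: OB.
Qed.

Lemma invlim_zero_dimensional : zero_dimensional L.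
Proof.
move=> x y xy; have [n nxy] : exists n, p n x <> p n y.
  by apply/existsNP => pxy; move/eqP: xy; apply; exact: invlim_ext.
exists (p n @^-1` [set p n x]); split=> //; last by move=> /esym.
split; [apply: discrete_preimage_open|apply: discrete_preimage_closed].
  exact: invlim_proj_continuous.
exact: invlim_proj_continuous.
Qed.

Lemma invlim_nbhs (x : L) (O : set L) :
  nbhs x O -> exists n, forall y, p n y = p n x -> O y.
Proof.
apply: (tower_nbhs invlim_compact invlim_proj_continuous).
  by move=> n y z yz; rewrite -(invlim_projS n y) yz invlim_projS.
exact: invlim_ext.
Qed.

Lemma invlim_nbhs_fiber n (x : L) : nbhs x [set y | p n y = p n x].
Proof.
apply: open_nbhs_nbhs; split=> //.
apply: (@discrete_preimage_open L _ (p n) [set p n x]).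
exact: invlim_proj_continuous.
Qed.

Fact invlim_mulg_continuous : continuous (fun z : L * L => z.1 * z.2).
Proof.
move=> [x y] O /invlim_nbhs[n nO].
exists ([set x' | p n x' = p n x], [set y' | p n y' = p n y]).
  by split; exact: invlim_nbhs_fiber.
move=> [x' y'] [/= xx' yy']; apply: nO.
by rewrite -[LHS]/(p n x' * p n y') xx' yy'.
Qed.

Fact invlim_invg_continuous : continuous (fun x : L => x^-1).
Proof.
move=> x O /invlim_nbhs[n nO]; apply: filterS (invlim_nbhs_fiber n x) => y yx.
by apply: nO; rewrite -[LHS]/((p n y)^-1) yx.
Qed.

HB.instance Definition _ := isTopologicalGroup.Build L
  invlim_mulg_continuous invlim_invg_continuous.

Fact invlim_hausdorff : hausdorff_space L.
Proof.
rewrite open_hausdorff => x y /invlim_zero_dimensional[A [[oA cA] Ax Ay]].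
exists (A, ~` A); first by split; rewrite inE.
by split=> //=; [exact: closed_openC|rewrite setICr].
Qed.

HB.instance Definition _ := TopologicalGroup_isProfinite.Build L
  invlim_compact invlim_hausdorff
  (zero_dimension_totally_disconnected invlim_zero_dimensional).

Definition invlim_group : profiniteGroupType := L.

End InverseLimit.

Section InverseLimitProfinite.
Variables (G : nat -> finGroupType) (t : forall n, G n.+1 -> G n).
Arguments t : clear implicits.
Hypothesis tS : forall n, surj_hom (t n).
Local Notation L := (invlim_group tS).
Local Notation p := (@invlim_proj G t tS).

(** Below [m] the entries are images of [y]; above, surjectivity of the transition maps supplies [k]
    successive preimages. Entries further up are arbitrary. *)
Lemma thread_through m (y : G m) k : exists x : forall n, G n,
  x m = y /\ forall n, (n < k + m)%N -> t n (x n.+1) = x n.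
Proof.
elim: k => [|k [x [xm xt]]].
  have [||x [xm _ xt]] := @konig_prefix G (fun _ _ => True)
    (fun n a b => t n b = a) _ _ m y I.
  - by move=> n; exists 1.
  - by move=> n b _; exists (t n b).
  - by exists x; split.
have [z zx] := (tS (k + m)).2 (x (k + m)%N).
exists (dfwith x (k + m).+1 z); split.
  by rewrite dfwithout// gtn_eqF// ltnS leq_addl.
move=> n; rewrite addSn ltnS leq_eqVlt => /orP[/eqP ->|nk].
  by rewrite dfwithin dfwithout ?zx// gtn_eqF.
rewrite !dfwithout; first exact: xt.
  by rewrite gtn_eqF// ltnW.
by rewrite eqSS gtn_eqF.
Qed.

(** Konig's lemma runs over entries of partial threads through [y]. The bound [n + m] is at least
    both [n] and [m], so the candidate at level [n] is linked to [y]. *)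
Lemma invlim_proj_surj m (y : G m) : exists x, p m x = y.
Proof.
have [||x xP] := @konig G
  (fun n z => exists x : forall n, G n, [/\ x n = z, x m = y &
     forall i, (i < n + m)%N -> t i (x i.+1) = x i])
  (fun n a b => t n b = a).
- by move=> n; have [x [xm xt]] := thread_through y n; exists (x n), x.
- move=> n _ [x [<- xm xt]]; exists (x n); last by apply: xt; rewrite leq_addr.
  by exists x; split=> // i im; apply: xt; rewrite ltnW.
exists (exist _ x (fun n => (xP n).2)).
by have [[x' [x'm x'y _]] _] := xP m; exact: (etrans (esym x'm) x'y).
Qed.

Lemma invlim_proj_mor n : prof_mor (p n).
Proof.
split; last exact: invlim_proj_continuous.
by split=> // y; exact: invlim_proj_surj.
Qed.

Lemma invlim_tower : is_tower p.
Proof.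
split; first exact: invlim_proj_mor.
  by move=> n x y xy; rewrite -(invlim_projS n x) xy invlim_projS.
exact: invlim_ext.
Qed.

Lemma open_normal_contains_fiber (M : set L) : open_normal M ->
  exists n, forall x, p n x = 1 -> M x.
Proof.
move=> [oM [[M1 _] _]].
have [n nM] := invlim_nbhs (open_nbhs_nbhs (conj oM M1)).
by exists n => x px; apply: nM; rewrite px (surj_hom1 (invlim_proj_mor n).1).
Qed.

(** Konig's lemma gives compatible generating tuples, hence elements [e i] of the limit. The
    subgroup they generate maps onto every [G n], so it meets all fibres of the projections; these
    form a neighbourhood basis, whence density. *)
Lemma invlim_finitely_generated r :
  (forall n, r_generated r (G n)) -> top_finitely_generated L.
Proof.
move=> Gr.
have [|n y gy|s sP] := @konig (fun n => {ffun 'I_r -> G n})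
  (fun n s => @generates r (G n) s)
  (fun n s s' => forall i, t n (s' i) = s i).
- by move=> n; exact: r_generatedP.
- exists [ffun i => t n (y i)]; last by move=> i; rewrite ffunE.
  rewrite (_ : [ffun i => _] = t n \o y :> (_ -> _)).
    exact: generates_image (tS n) gy.
  by apply/funext => i; rewrite ffunE.
pose e i : invlim tS := exist (fun x : forall n, G n => forall n,
  t n (x n.+1) = x n) (fun n => s n i) (fun n => (sP n).2 i).
exists [seq e i : L | i <- enum 'I_r]; rewrite -subTset => x _ O.
move=> /invlim_nbhs[n nO].
set S := smallest _ _.
have : (p n @` S) = setT.
  apply: (sP n).1.
    exact/image_subgroup/smallest_subgroup/(invlim_proj_mor n).1.
  move=> i; exists (e i) => //; apply: sub_gen_smallest.
  by apply/mapP; exists i => //; rewrite mem_enum.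
move=> /seteqP[_ /(_ (p n x) I)[y Sy yx]].
by exists y; split=> //; exact: nO.
Qed.

Lemma invlim_profinite_ext (U : FinGrp -> Prop) r :
  (forall n, U (G n)) -> (forall n, r_generated r (G n)) -> profinite_ext U L.
Proof.
move=> UG Gr; split; first exact: invlim_finitely_generated Gr.
move=> M /open_normal_contains_fiber[n nM]; exists [set x | p n x = 1] => //.
have pm := invlim_proj_mor n; split; first exact: kernel_open_normal.
by exists (G n), (p n); split=> //; exact: pm.1.
Qed.

Lemma invlim_proj_le m n x y : (m <= n)%N -> p n x = p n y -> p m x = p m y.
Proof.
elim: n => [|n IHn]; first by rewrite leqn0 => /eqP->.
rewrite leq_eqVlt => /orP[/eqP->//|mn xy]; apply: IHn => //.
by have [_ pS _] := invlim_tower; exact: pS.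
Qed.

(** By continuity [f] factors through some stage, and it descends to [n] one stage at a time: [K]
    lies in every [V (n + k)], so the reflection [t (n + k)] carries a factorization from stage
    [n + k + 1] to stage [n + k]. *)
Lemma invlim_proj_reflection (V : nat -> FinGrp -> Prop) :
  (forall n H, V n H -> V n.+1 H) -> (forall n, V n (G n)) ->
  (forall n, @is_reflection (V n) (discrete_group (G n.+1)) (G n) (t n)) ->
  forall n, is_reflection (V n) (p n).
Proof.
move=> Vmono VG tR n; split=> // [|K f VK fm]; first exact: invlim_proj_mor.
have [m mf] : exists m, forall x y, p m x = p m y -> f x = f y.
  have [m mf] := open_normal_contains_fiber (kernel_open_normal fm).
  exists m => x y xy; apply: (mulIg (f y)^-1); rewrite mulgV.
  have pS := (invlim_proj_mor m).1.
  rewrite -(surj_homV fm.1) -fm.1.1; apply: mf.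
  by rewrite pS.1 (surj_homV pS) xy mulgV.
(* Starting the descent at stage [n + m], which is at least [m], avoids comparing [m] with [n]. *)
suff /(_ m) : forall k,
    (forall x y, p (n + k)%N x = p (n + k)%N y -> f x = f y) ->
    forall x y, p n x = p n y -> f x = f y.
  apply=> x y xy; apply: mf; apply: invlim_proj_le xy; exact: leq_addl.
have VK' k : V (n + k)%N K.
  by elim: k => [|k IHk]; rewrite ?addn0// addnS; exact: Vmono.
elim=> [|k IHk fk]; first by rewrite addn0.
apply: IHk => x y xy.
rewrite addnS in fk.
have [g gS fE] := surj_hom_quotient (invlim_proj_mor _).1 fm.1 fk.
have [_ _ tU] := tR (n + k)%N.
rewrite fE /=; apply: (tU K g (VK' k) (discrete_prof_mor gS)).
by rewrite !invlim_projS.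
Qed.

End InverseLimitProfinite.

(** * The limit map *)

Section Reflections.
Variables (U : FinGrp -> Prop) (Un : nat -> FinGrp -> Prop).
Hypothesis filt : reflective_filtration U Un.

Lemma reflections_separate (G : profiniteGroupType) (K : nat -> finGroupType)
    (p : forall n, G -> discrete_group (K n)) :
  profinite_ext U G -> (forall n, is_reflection (Un n) (p n)) ->
  forall x y, (forall n, p n x = p n y) -> x = y.
Proof.
move=> [_ GU] pR x y pxy; apply: contrapT => xy.
have [|M oM nM] := @profinite_residual G (x * y^-1).
  by move=> xy1; apply: xy; apply: (mulIg y^-1); rewrite mulgV.
have [N [[oN _] [L [f [UL fS NE]]]] NM] := GU M oM.
have [n VL] := filt_cover filt UL.
have [_ _ pU] := pR n.
have fm : @prof_mor G (discrete_group L) f.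
  by split=> //; apply: open_kernel_continuous => //; rewrite -NE.
apply/nM/NM; rewrite NE /= fS.1 (surj_homV fS).
by rewrite (pU L f VL fm x y (pxy n)) mulgV.
Qed.

(** As [K n] also belongs to [Un n.+1], the universal property of [p n.+1] applies to [p n]. *)
Lemma reflections_tower (G : profiniteGroupType) (K : nat -> finGroupType)
    (p : forall n, G -> discrete_group (K n)) :
  profinite_ext U G -> (forall n, is_reflection (Un n) (p n)) -> is_tower p.
Proof.
move=> GU pR; split; last exact: reflections_separate.
  by move=> n; have [] := pR n.
move=> n; have [VK pm _] := pR n; have [_ _ pU] := pR n.+1.
exact: pU (filt_mono filt VK) pm.
Qed.

Variable q : forall n, functor (full_sub (profinite_ext U)) (full_sub (Un n)).
Hypothesis q_adj : forall n, is_left_adjoint (q n) (filt_incl_ext filt n).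

Lemma reflection_exists (G : full_sub (profinite_ext U)) (n : nat) :
  exists p : sval G -> discrete_group (sval (q n G)), is_reflection (Un n) p.
Proof. exact: left_adjoint_reflection (q_adj n). Qed.

(** This trades isomorphism classes for actual quotient maps with a prescribed target. *)
Lemma reflection_isomorphic (G : full_sub (profinite_ext U)) (n : nat)
    (X : full_sub (Un n)) :
  isomorphic (q n G) X <->
  exists p : sval G -> discrete_group (sval X), is_reflection (Un n) p.
Proof.
have [p pR] := reflection_exists G n; rewrite isomorphic_group_iso.
split=> [[f fS fI]|[p' pR']]; last exact: is_reflection_iso pR pR'.
have [_ pm pU] := pR.
exists (f \o p); split; first exact: svalP.
  exact: prof_mor_comp (discrete_prof_mor fS) pm.
by move=> L g VL gm x y /= /fI; exact: pU.
Qed.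

Lemma pi0_limit_map_inj : injective (pi0_limit_map q_adj).
Proof.
move=> A B; have [G ->] := pi0_ind A; have [H ->] := pi0_ind B.
move=> /(congr1 sval) /= GH; apply/pi0_class_eq.
pose p n := sval (cid (reflection_exists G n)).
pose p' n := sval (cid (reflection_exists H n)).
have pR n : is_reflection (Un n) (p n) by exact: svalP (cid _).
have pR' n : is_reflection (Un n) (p' n) by exact: svalP (cid _).
have pT := reflections_tower (svalP G) pR.
have pT' := reflections_tower (svalP H) pR'.
apply: (tower_isomorphic pT pT' pR) => n; first exact: svalP.
apply/isomorphic_group_iso/pi0_class_eq; rewrite -!pi0_mapE.
exact: (congr1 (@^~ n) GH).
Qed.

Lemma pi0_limit_map_surj r (s : pi0_limit filt q) :
  (forall G : FinGrp, U G -> r_generated r G) ->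
  exists A, pi0_limit_map q_adj A = s.
Proof.
move=> Ur; pose X n := sval (cid (pi0_ind (sval s n))).
have sX n : sval s n = pi0_class (X n) by rewrite /X; case: cid.
pose K n := sval (X n).
(* Compatibility of [s] says that [q n] sends the class of [X n.+1] to that of [X n]; the transition
   map is thus a reflection of the discrete group [K n.+1]. *)
have tE n : exists t : discrete_group (K n.+1) -> discrete_group (K n),
    is_reflection (Un n) t.
  apply/(reflection_isomorphic (filt_incl_ext filt n.+1 (X n.+1)) (X n)).
  apply/pi0_class_eq; rewrite -sX -(svalP s n) sX.
  by rewrite /pi0_transition pi0_mapE.
pose t n := sval (cid (tE n)).
have tR n : is_reflection (Un n) (t n) by exact: svalP (cid _).
have tS n : @surj_hom (K n.+1) (K n) (t n) by have [_ [? _] _] := tR n.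
have UK n : U (K n) by exact: (filt_sub filt (svalP (X n))).
have LU : profinite_ext U (invlim_group tS).
  exact: invlim_profinite_ext UK (fun n => Ur _ (UK n)).
pose L : full_sub (profinite_ext U) := exist _ (invlim_group tS) LU.
exists (pi0_class L); apply: eq_sig_hprop => [? ? ?|].
  exact: Prop_irrelevance.
apply: functional_extensionality_dep => n.
rewrite /= pi0_mapE sX; apply/pi0_class_eq/reflection_isomorphic.
exists (@invlim_proj _ _ tS n).
exact: (@invlim_proj_reflection K t tS Un (@filt_mono _ _ filt)
  (fun n => svalP (X n)) tR n).
Qed.

End Reflections.

Theorem theorem11p13 (r : nat)
    (U : FinGrp -> Prop)
    (U_replete : replete U)
    (U_widely_closed : widely_closed U)
    (U_r_generated : forall G : FinGrp, U G -> r_generated r G)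
    (Un : nat -> FinGrp -> Prop)
    (Un_filt : reflective_filtration U Un)
    (q : forall n, functor (full_sub (profinite_ext U)) (full_sub (Un n)))
    (q_adj : forall n, is_left_adjoint (q n) (filt_incl_ext Un_filt n)) :
  bijective (pi0_limit_map q_adj).
Proof.
have [g gK] := choice (fun s => pi0_limit_map_surj q_adj s U_r_generated).
by exists g => // A; apply: (pi0_limit_map_inj (q_adj := q_adj)); rewrite gK.
Qed.
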